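(* Let $K$ be a compact Hausdorff topological space, let $n$ be an even (positive) integer and let $s,t$ be distinct points in $K$. (a) $\delta_t^n$ is a weak$^*$ strongly exposed point of the unit ball of $(\mathcal{P}_o(^nC(K)),\|\cdot\|_\infty)$ if and only if $t$ is an isolated point of $K$. (b) $\delta_t^n-\delta_s^n$ is a weak$^*$ strongly exposed point of the unit ball of $(\mathcal{P}_o(^nC(K)),\|\cdot\|_\infty)$ if and only if $t$ and $s$ are isolated points of $K$.
   Context: $C(K)$ is the space of continuous real functions on $K$. An $n$-homogeneous polynomial on $C(K)$ is a function $P(x)=A(x,\dots,x)$ with $A$ a bounded $n$-linear form on $(C(K),\|\cdot\|_\infty)$; it is orthogonally additive if $P(x+y)=P(x)+P(y)$ whenever $|x|\wedge|y|=0$. $\mathcal{P}_o(^nC(K))$ is the space of orthogonally additive $n$-homogeneous polynomials, with norm $\|P\|_\infty=\sup\{|P(x)|:\|x\|_\infty\le1\}$. $\delta_t^n$ is the polynomial $x\mapsto x(t)^n$. Duality: every $P\in\mathcal{P}_o(^nC(K))$ has the form $P(x)=\int_K x^n\,d\mu$ for a unique regular Borel signed measure $\mu$ on $K$, and for $n$ even $\mu\mapsto P$ is an isometric isomorphism of $(\mathcal{M}(K),\|\cdot\|_0)$ onto $(\mathcal{P}_o(^nC(K)),\|\cdot\|_\infty)$, where $\mathcal{M}(K)$ is the space of regular Borel signed measures and $\|\mu\|_0=\max\{\mu^+(K),\mu^-(K)\}$. Moreover $(\mathcal{M}(K),\|\cdot\|_0)$ is the dual of $(C(K),\|\cdot\|_d)$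 under $\langle x,\mu\rangle=\int_K x\,d\mu$, where $\|x\|_d=\|x^+\|_\infty+\|x^-\|_\infty$. Via these identifications $\mathcal{P}_o(^nC(K))$ is regarded as the dual of $(C(K),\|\cdot\|_d)$, and weak$^*$ notions refer to this duality. If $E=F'$ is a dual Banach space, a point $u$ in the closed unit ball $\overline{B}_E$ is a weak$^*$ strongly exposed point of $\overline{B}_E$ if there is $\varphi\in F$ with $\|\varphi\|=1$ such that $\langle\varphi,u\rangle=1$ and, whenever $(u_k)_k$ is a sequence in $\overline{B}_E$ with $\lim_k\langle\varphi,u_k\rangle=1$, then $u_k\to u$ in norm. *)

(* Defs.v *)
(* MathComp-Analysis *)
From HB Require Import structures.
From mathcomp Require Import all_boot all_order all_algebra.
From mathcomp Require Import all_classical all_reals all_analysis.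

Set Implicit Arguments.
Unset Strict Implicit.
Unset Printing Implicit Defensive.

Import Order.TTheory GRing.Theory Num.Theory.
Import numFieldNormedType.Exports.

Local Open Scope classical_set_scope.
Local Open Scope ring_scope.

(* The pointwise vector space structure on C(K) = [continuousType K R]. *)
Section continuous_lmodule.
Context {K : topologicalType} {R : realType}.
Implicit Types (f g h : continuousType K R) (a b : R).

Let cts_addP f g : continuous (fun t => f t + g t).
Proof. by move=> t; apply: cvgD; exact: cts_fun. Qed.

Let cts_oppP f : continuous (fun t => - f t).
Proof. by move=> t; apply: cvgN; exact: cts_fun. Qed.

Let cts_scaleP a f : continuous (fun t => a * f t).
Proof. by move=> t; apply: cvgM; [exact: cvg_cst|exact: cts_fun]. Qed.

Definition cts_zero : continuousType K R := cst 0.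
Definition cts_add f g : continuousType K R := mkcts (@cts_addP f g).
Definition cts_opp f : continuousType K R := mkcts (@cts_oppP f).
Definition cts_scale a f : continuousType K R := mkcts (@cts_scaleP a f).

Let cts_addA : associative cts_add.
Proof. by move=> f g h; apply/continuousEP => t /=; exact: addrA. Qed.

Let cts_addC : commutative cts_add.
Proof. by move=> f g; apply/continuousEP => t /=; exact: addrC. Qed.

Let cts_add0 : left_id cts_zero cts_add.
Proof. by move=> f; apply/continuousEP => t /=; exact: add0r. Qed.

Let cts_addN : left_inverse cts_zero cts_opp cts_add.
Proof. by move=> f; apply/continuousEP => t /=; exact: addNr. Qed.

HB.instance Definition _ := GRing.isZmodule.Build (continuousType K R)
  cts_addA cts_addC cts_add0 cts_addN.

Let cts_scaleA a b f : cts_scale a (cts_scale b f) = cts_scale (a * b) f.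
Proof. by apply/continuousEP => t /=; exact: mulrA. Qed.

Let cts_scale1 : left_id 1 cts_scale.
Proof. by move=> f; apply/continuousEP => t /=; exact: mul1r. Qed.

Let cts_scaleDr : right_distributive cts_scale +%R.
Proof. by move=> a f g; apply/continuousEP => t /=; exact: mulrDr. Qed.

Let cts_scaleDl f : {morph cts_scale^~ f : a b / a + b}.
Proof. by move=> a b; apply/continuousEP => t /=; exact: mulrDl. Qed.

HB.instance Definition _ := GRing.Zmodule_isLmodule.Build R
  (continuousType K R) cts_scaleA cts_scale1 cts_scaleDr cts_scaleDl.

End continuous_lmodule.

Section norms.
Context {K : topologicalType} {R : realType}.

(* A real supremum: used only on bounded functions, 0 when K is empty. *)
Definition supnorm (f : K -> R) : R := sup [set `|f t| | t in [set: K]].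

Definition dnorm (x : continuousType K R) : R :=
  supnorm x^\+ + supnorm x^\-.

(* ||P||_oo; meaningful for P bounded on the unit ball of C(K). *)
Definition polynorm (P : continuousType K R -> R) : R :=
  sup [set `|P x| | x in [set x : continuousType K R | supnorm x <= 1]].

End norms.

Section polynomials.
Context {K : topologicalType} {R : realType}.

(* [dfwith v i x] is the family v with its i-th entry replaced by x. *)
Definition multilinear (n : nat) (A : ('I_n -> continuousType K R) -> R) :=
  forall i (v : 'I_n -> continuousType K R) (a : R)
         (x y : continuousType K R),
    A (dfwith v i (a *: x + y)) = a * A (dfwith v i x) + A (dfwith v i y).

Definition bounded_form (n : nat) (A : ('I_n -> continuousType K R) -> R) :=
  exists M : R, forall v, `|A v| <= M * \prod_(i < n) supnorm (v i).

Definition homogeneous_poly (n : nat) (P : continuousType K R -> R) :=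
  exists A : ('I_n -> continuousType K R) -> R,
    [/\ multilinear A, bounded_form A & forall x, P x = A (fun=> x)].

Definition orthogonally_additive (P : continuousType K R -> R) :=
  forall x y : continuousType K R,
    (forall t, Num.min `|x t| `|y t| = 0) -> P (x + y) = P x + P y.

Definition orthadd_poly (n : nat) : set (continuousType K R -> R) :=
  [set P | homogeneous_poly n P /\ orthogonally_additive P].

Definition delta_poly (n : nat) (t : K) : continuousType K R -> R :=
  fun x => x t ^+ n.

End polynomials.

(* The base point of K is required by [measurableType]; it carries no content
   beyond K being nonempty. *)
Definition borel (K : ptopologicalType) := g_sigma_algebraType (@open K).

Section signed_measures.
Context {K : ptopologicalType} {R : realType}.
Implicit Types nu : {charge set (borel K) -> \bar R}.

Definition hahn_pos nu : set (borel K) := projT1 (cid (Hahn_decomposition nu)).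

Definition hahn_neg nu : set (borel K) :=
  projT1 (cid (projT2 (cid (Hahn_decomposition nu)))).

Definition hahn_posneg nu : hahn_decomposition nu (hahn_pos nu) (hahn_neg nu) :=
  projT2 (cid (projT2 (cid (Hahn_decomposition nu)))).

(* Independent of the chosen Hahn decomposition, by uniqueness of nu^+, nu^-. *)
Definition charge_integral nu (f : K -> R) : R :=
  Rintegral (jordan_pos (hahn_posneg nu)) [set: borel K] f -
  Rintegral (jordan_neg (hahn_posneg nu)) [set: borel K] f.

Definition regular_measure (mu : set (borel K) -> \bar R) :=
  forall A : set (borel K), measurable A ->
    mu A = ereal_inf [set mu U | U in [set U : set K | open U /\ A `<=` U]] /\
    mu A = ereal_sup [set mu C | C in [set C : set K | compact C /\ C `<=` A]].

Definition regular_charge nu :=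
  regular_measure (charge_variation (hahn_posneg nu)).

Definition represents (n : nat) nu (P : continuousType K R -> R) :=
  forall x, P x = charge_integral nu (fun t => x t ^+ n).

End signed_measures.

(* <x, P> is the integral of x against the regular Borel signed measure
   representing P. For P in P_o(^n C(K)), n > 0, this measure exists and is
   unique, so the default value 0 is never used. *)
Definition duality {K : ptopologicalType} {R : realType} (n : nat)
    (x : continuousType K R) (P : continuousType K R -> R) : R :=
  xget 0 [set r | exists nu : {charge set (borel K) -> \bar R},
    [/\ regular_charge nu, represents n nu P & r = charge_integral nu x]].

(* E, a subspace of V normed by normE, is the dual of (F, normF) under
   [pairing]. *)
Definition weak_star_strongly_exposed {R : realType} {F : Type} {V : zmodType}
    (normF : F -> R) (E : set V) (normE : V -> R) (pairing : F -> V -> R)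
    (u : V) :=
  let ball := [set v | E v /\ normE v <= 1] in
  ball u /\
  exists phi : F, [/\ normF phi = 1, pairing phi u = 1 &
    forall u_ : nat -> V, (forall k, ball (u_ k)) ->
      pairing phi (u_ k) @[k --> \oo] --> (1 : R) ->
      normE (u_ k - u) @[k --> \oo] --> (0 : R)].

Definition weak_star_strongly_exposed_poly {K : ptopologicalType}
    {R : realType} (n : nat) (P : continuousType K R -> R) :=
  weak_star_strongly_exposed dnorm (orthadd_poly n) polynorm (duality n) P.

(* Main.v *)
Require Import Defs.
From HB Require Import structures.
From mathcomp Require Import all_boot all_order all_algebra.
From mathcomp Require Import all_classical all_reals all_analysis.
From mathcomp Require Import measurable_realfun lra.

Set Implicit Arguments.
Unset Strict Implicit.
Unset Printing Implicit Defensive.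

Import Order.TTheory GRing.Theory Num.Theory.
Import numFieldNormedType.Exports.

Local Open Scope classical_set_scope.
Local Open Scope ring_scope.

(** Near a non-isolated point the evaluations delta_r^n are weak* close but far
    apart in norm, so an atom there cannot be strongly exposed; the indicators of
    isolated points are continuous and provide exposing functions.

    The pairing.  If nu represents P, that is if P(x) is the integral of x^n,
    then the integral of any continuous f against nu is determined by P, because
    f + M and M are nonnegative for M = ||f||_oo and hence are n-th powers of
    continuous functions ([represents_uniq]).  For P = c delta_p^n + d delta_q^n
    with p <> q the pairing with f is therefore c f(p) + d f(q), once the atomic
    charge c delta_p + d delta_q is known to be regular ([duality_two_point]).
    For an arbitrary P the pairing takes the default value 0 unless some charge
    represents P, so the terms of a sequence whose pairings tend to 1 are
    eventually represented by charges ([duality_neq0]).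

    Exposed implies isolated ([exposed_two_point_isolated]).  Let phi expose
    c delta_p^n + d delta_q^n with c nonzero, and suppose that p is not
    isolated.  By continuity of phi there are points r_k distinct from p and q
    with phi(r_k) -> phi(p).  The polynomials c delta_(r_k)^n + d delta_q^n lie
    in the ball and their pairings with phi tend to 1, but a Urysohn function
    with value 0 at p and 1 at r_k shows that they stay at distance at least
    |c| from c delta_p^n + d delta_q^n.

    Isolated implies exposed.  Here delta_p^n is exposed by (1_p + 1)/2, and
    delta_p^n - delta_q^n by (1_p - 1_q)/2.  Let L f be the integral of f against
    a charge representing some P in the ball.  Then L is linear, and |L f| <= 1
    whenever 0 <= f <= 1, because f is the n-th power of a function in the unit
    ball.  Applying this bound to a few test functions gives
    |L f - u(f)| <= 4 (1 - L phi) for all such f, where u is the functional to be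
    exposed ([isolated_exposed_one], [isolated_exposed_sub]).  Since n is even,
    f = x^n is admissible for every x in the unit ball of C(K), so this is a
    bound on the norm of the difference of polynomials ([two_point_exposed]). *)

(** * Continuous functions on a compact Hausdorff space *)

Section continuous_functions.
Context {K : ptopologicalType} {R : realType}.
Context (compK : compact [set: K]).
Implicit Types f g : continuousType K R.

Lemma has_sup_supnorm f : has_sup [set `|f t| | t in [set: K]].
Proof.
split; first by exists `|f point|, point.
have /compact_bounded : compact (range f).
  by apply: continuous_compact => //; apply/continuous_subspaceT; exact: cts_fun.
case=> M [_ /(_ (M + 1))]; rewrite ltrDl ltr01 => /(_ isT) fM.
by exists (M + 1) => _ [t _ <-]; apply: fM; exists t.
Qed.

Lemma le_supnorm f t : `|f t| <= supnorm f.
Proof. by apply: sup_upper_bound; [exact: has_sup_supnorm|exists t]. Qed.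

Lemma supnorm_ge0 f : 0 <= supnorm f.
Proof. exact: le_trans (normr_ge0 _) (le_supnorm f point). Qed.

Lemma supnorm_le (h : K -> R) M : (forall t, `|h t| <= M) -> supnorm h <= M.
Proof.
move=> hM; apply: ge_sup; first by exists `|h point|, point.
by move=> _ [t _ <-].
Qed.

Lemma supnorm_max (h : K -> R) t :
  (forall q, `|h q| <= `|h t|) -> supnorm h = `|h t|.
Proof.
move=> ht; apply/eqP; rewrite eq_le supnorm_le//=.
by apply: ub_le_sup; [exists `|h t| => _ [q _ <-]|exists t].
Qed.

Lemma supnorm_le1 f : supnorm f <= 1 <-> forall t, `|f t| <= 1.
Proof.
by split=> [f1 t|]; [exact: le_trans (le_supnorm f t) f1|exact: supnorm_le].
Qed.

(** Nonnegative continuous functions are n-th powers, which lets values of an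
    n-homogeneous polynomial be read as integrals of arbitrary functions. The
    root is uniformly continuous because powers are superadditive on
    nonnegative reals: a < b + e^n forces a^(1/n) < b^(1/n) + e. *)
Lemma exists_root n f : (0 < n)%N -> (forall t, 0 <= f t) ->
  exists x : continuousType K R, forall t, 0 <= x t /\ x t ^+ n = f t.
Proof.
move=> n0 f0; pose r a : R := a `^ n%:R^-1.
have r0 a : 0 <= r a by exact: powR_ge0.
have rK a : 0 <= a -> r a ^+ n = a.
  move=> a0; rewrite -powR_mulrn// -powRrM mulVf ?powRr1//.
  by rewrite pnatr_eq0 -lt0n.
have superadd (a b : R) m : (0 < m)%N -> 0 <= a -> 0 <= b ->
    a ^+ m + b ^+ m <= (a + b) ^+ m.
  case: m => // m _ a0 b0; elim: m => [|m IH]; first by rewrite !expr1.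
  rewrite exprS; apply: (@le_trans _ _ ((a + b) * (a ^+ m.+1 + b ^+ m.+1))).
    have := mulr_ge0 a0 (exprn_ge0 m.+1 b0).
    have := mulr_ge0 b0 (exprn_ge0 m.+1 a0).
    by rewrite ![_ ^+ m.+2]exprS; lra.
  by rewrite ler_wpM2l// addr_ge0.
have r_lt a b e : 0 <= a -> 0 <= b -> 0 < e -> a < b + e ^+ n -> r a < r b + e.
  move=> a0 b0 e0 abe; rewrite ltNge; apply/negP => h.
  have : (r b + e) ^+ n <= r a ^+ n.
    by rewrite ler_pXn2r// ?nnegrE ?addr_ge0// ltW.
  rewrite rK// leNgt (lt_le_trans abe)//.
  by rewrite -[leLHS](congr1 (+%R^~ _) (rK b b0)) superadd// ltW.
have rc : continuous (r \o f).
  move=> t; apply/cvgrPdist_lt => e e0.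
  have en0 : 0 < e ^+ n by rewrite exprn_gt0.
  have := @cts_fun _ _ f t.
  move=> /cvgrPdist_lt/(_ _ en0); apply: filterS => q.
  rewrite !ltr_norml/= => /andP[h1 h2].
  have := @r_lt (f t) (f q) e (f0 _) (f0 _) e0.
  have := @r_lt (f q) (f t) e (f0 _) (f0 _) e0.
  move=> /(_ ltac:(lra)) ? /(_ ltac:(lra)) ?.
  by apply/andP; split; lra.
by exists (mkcts rc) => t /=; split; [exact: r0|exact: rK].
Qed.

Lemma continuous_pow n f : continuous (fun t => f t ^+ n).
Proof.
move=> t; apply: (continuous_comp (g := fun a : R => a ^+ n)).
  exact: cts_fun.
exact: exprn_continuous.
Qed.
Definition cts_pow n f : continuousType K R := mkcts (@continuous_pow n f).

Lemma isolated_open (t : K) : isolated [set: K] t -> open [set t].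
Proof.
case=> _ [V Vt]; rewrite setIT => VE.
by rewrite openE => q /= ->; rewrite /interior -VE.
Qed.

Lemma not_isolated (t : K) : ~ isolated [set: K] t ->
  forall V, nbhs t V -> exists2 q, V q & q <> t.
Proof.
move=> nt V Vt; apply: contrapT => /forall2NP h; apply: nt.
split; first by rewrite inE.
exists V => //; rewrite setIT; apply/seteqP; split => q /=.
  by move=> Vq; case: (h q) => // /contrapT.
by move=> ->; exact: nbhs_singleton.
Qed.

Context (hausK : hausdorff_space K).

Lemma closed_singleton (t : K) : closed [set t].
Proof. exact: accessible_closed_set1 (hausdorff_accessible hausK) t. Qed.

Lemma exists_indic (t : K) : isolated [set: K] t ->
  exists e : continuousType K R, forall q, e q = (q == t)%:R.
Proof.
move=> /isolated_open ot.
suff ec : continuous (fun q : K => (q == t)%:R : R) by exists (mkcts ec).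
move=> q; apply: (@cvg_trans _ ((cst (q == t)%:R : K -> R) @ q)); last exact: cvg_cst.
apply: near_eq_cvg.
have [->|/eqP qt] := eqVneq q t.
  have : nbhs t [set t] by exact: open_nbhs_nbhs.
  by apply: filterS => p /= ->; rewrite eqxx.
have : nbhs q (~` [set t]).
  by apply: open_nbhs_nbhs; split => //; rewrite openC; exact: closed_singleton.
by apply: filterS => p /= /eqP/negbTE ->.
Qed.

Lemma exists_separating (t q : K) : t <> q ->
  exists e : continuousType K R, [/\ forall p, 0 <= e p <= 1, e t = 0 & e q = 1].
Proof.
move=> tq.
have := compact_normal hausK compK.
move=> /(@normal_separatorP R) /(_ [set t] [set q] (@closed_singleton _) (@closed_singleton _)).
move=> /(_ ltac:(by rewrite -subset0 => p /= [-> /tq])).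
move=> /(@uniform_separatorP _ R)[f [fc f01 f0 f1]].
exists (mkcts fc); split => [p||].
- by have := f01 (f p); rewrite /= in_itv/=; apply; exists p.
- by apply: f0; exists t.
- by apply: f1; exists q.
Qed.

End continuous_functions.

(** * Atomic orthogonally additive polynomials *)

Section polynomials.
Context {K : ptopologicalType} {R : realType}.
Context (compK : compact [set: K]).
Implicit Types (x : continuousType K R) (P : continuousType K R -> R).

Lemma homogeneous_bounded n P : homogeneous_poly n P ->
  has_ubound [set `|P x| | x in [set x : continuousType K R | supnorm x <= 1]].
Proof.
case=> A [_ [M AM] PA]; exists `|M| => _ [x /= x1 <-].
rewrite PA (le_trans (AM _))// prodr_const card_ord.
have x0 := supnorm_ge0 compK x.
have xn0 : 0 <= supnorm x ^+ n by rewrite exprn_ge0.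
rewrite (le_trans (ler_wpM2r xn0 (ler_norm M)))// ler_piMr//.
by rewrite exprn_ile1.
Qed.

Lemma le_polynorm n P x : homogeneous_poly n P -> supnorm x <= 1 ->
  `|P x| <= polynorm P.
Proof.
by move=> /homogeneous_bounded Pb x1; apply: ub_le_sup => //; exists x.
Qed.

Lemma polynorm_le P M : (forall x, supnorm x <= 1 -> `|P x| <= M) ->
  polynorm P <= M.
Proof.
move=> PM; apply: ge_sup; last by move=> _ [x /= x1 <-]; exact: PM.
exists `|P 0|, 0 => //=.
by rewrite supnorm_le// => t; rewrite normr0.
Qed.

(** If P is unbounded on the unit ball, then its norm is the default value 0 of
    the supremum. *)
Lemma polynorm_ge0 P : 0 <= polynorm P.
Proof.
rewrite /polynorm; set S := (X in sup X).
have [supS|/sup_out ->//] := pselect (has_sup S).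
have [_ [x x1 _]] := supS.1.
apply: le_trans (normr_ge0 (P x)) _.
by apply: sup_upper_bound supS _ _; exists x.
Qed.

Definition two_point_poly n (c d : R) (p q : K) : continuousType K R -> R :=
  fun x => c * x p ^+ n + d * x q ^+ n.

Lemma delta_two_point n p q :
  delta_poly n p = two_point_poly n 1 0 p q :> (continuousType K R -> R).
Proof. by apply/funext => x; rewrite /two_point_poly mul1r mul0r addr0. Qed.

Lemma delta_sub_two_point n p q :
  delta_poly n p - delta_poly n q =
  two_point_poly n 1 (-1) p q :> (continuousType K R -> R).
Proof. by apply/funext => x; rewrite /two_point_poly mul1r mulN1r. Qed.

Lemma two_point_polyC n c d p q :
  two_point_poly n c d p q = two_point_poly n d c q p.
Proof. by apply/funext => x; rewrite /two_point_poly addrC. Qed.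

Lemma two_point_poly_homogeneous n c d p q :
  homogeneous_poly n (two_point_poly n c d p q).
Proof.
exists (fun v => c * (\prod_(i < n) v i p) + d * (\prod_(i < n) v i q)); split.
- move=> i v a x y.
  have prodE r z : \prod_(j < n) dfwith v i z j r =
      z r * \prod_(j < n | j != i) v j r.
    rewrite (bigD1 i)//= dfwithin; congr (_ * _).
    by apply: eq_bigr => j ji; rewrite dfwithout// eq_sym.
  rewrite !prodE /=.
  have linE r : (a *: x + y) r = a * x r + y r by [].
  by rewrite !linE; lra.
- exists (`|c| + `|d|) => v.
  have prod_le r : `|\prod_(i < n) v i r| <= \prod_(i < n) supnorm (v i).
    rewrite normr_prod; apply: ler_prod => i _.
    by rewrite normr_ge0 le_supnorm.
  rewrite mulrDl (le_trans (ler_normD _ _))// !normrM.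
  by rewrite lerD// ler_wpM2l.
- by move=> x; rewrite !prodr_const card_ord.
Qed.

Lemma two_point_poly_orthadd n c d p q : (0 < n)%N ->
  orthadd_poly n (two_point_poly n c d p q).
Proof.
move=> n0; split; first exact: two_point_poly_homogeneous.
move=> x y xy; rewrite /two_point_poly.
suff powD r : (x + y) r ^+ n = x r ^+ n + y r ^+ n by rewrite !powD; lra.
have -> : (x + y) r = x r + y r by [].
have := xy r; rewrite minEle; case: ifP => _ /normr0_eq0 ->.
  by rewrite add0r expr0n gtn_eqF// add0r.
by rewrite addr0 expr0n gtn_eqF// addr0.
Qed.

Lemma pow_itv n x t : ~~ odd n -> supnorm x <= 1 -> 0 <= x t ^+ n <= 1.
Proof.
move=> en /(supnorm_le1 compK)/(_ t) xt.
rewrite exprn_even_ge0//= -(ger0_norm (exprn_even_ge0 _ en)) normrX.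
by rewrite exprn_ile1.
Qed.

(** An atomic measure with masses c and d at two distinct points has positive
    and negative parts of mass at most 1 exactly under this condition. *)
Definition unit_weights (c d : R) :=
  forall a b, 0 <= a <= 1 -> 0 <= b <= 1 -> `|c * a + d * b| <= 1.

Lemma two_point_poly_ball n c d p q : (0 < n)%N -> ~~ odd n ->
  unit_weights c d ->
  orthadd_poly n (two_point_poly n c d p q) /\
  polynorm (two_point_poly n c d p q) <= 1.
Proof.
move=> n0 en cd; split; first exact: two_point_poly_orthadd.
by apply: polynorm_le => x x1; apply: cd; exact: pow_itv.
Qed.

End polynomials.

(** * Integration against Borel charges *)

Section integration.
Context {K : ptopologicalType} {R : realType}.
Context (compK : compact [set: K]).
Implicit Types (f g : continuousType K R) (nu : {charge set (borel K) -> \bar R}).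

Lemma open_borel (U : set K) : open U -> measurable (U : set (borel K)).
Proof. exact: sub_sigma_algebra. Qed.

Lemma closed_borel (C : set K) : closed C -> measurable (C : set (borel K)).
Proof.
move=> cC; rewrite -[C]setCK; apply: measurableC; apply: open_borel.
exact: closed_openC.
Qed.

Lemma measurable_cts f : measurable_fun [set: borel K] (f : borel K -> R).
Proof.
apply: (measurability _ (RGenOpens.measurableE R)) => _ [_ [a [b ->] <-]].
rewrite setTI; apply: open_borel.
by apply: open_comp; [move=> t _; exact: cts_fun|exact: interval_open].
Qed.

Lemma integrable_cts (mu : {finite_measure set (borel K) -> \bar R}) f :
  mu.-integrable [set: borel K] (EFin \o (f : borel K -> R)).
Proof.
apply: measurable_bounded_integrable => //.
- exact: fin_num_fun_lty.
- exact: measurable_cts.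
- exists (supnorm f); split; first exact: num_real.
  by move=> M fM t _; exact: le_trans (le_supnorm compK f t) (ltW fM).
Qed.

Lemma charge_integral_linear nu a f g :
  charge_integral nu (a *: f + g) = a * charge_integral nu f + charge_integral nu g.
Proof.
rewrite /charge_integral.
have lin (mu : {finite_measure set (borel K) -> \bar R}) :
    Rintegral mu [set: borel K] (a *: f + g : continuousType K R) =
    a * Rintegral mu [set: borel K] f + Rintegral mu [set: borel K] g.
  rewrite -RintegralZl//; last exact: integrable_cts.
  by rewrite -RintegralD//; [exact: (integrable_cts mu (a *: f))|exact: integrable_cts].
by rewrite !lin; lra.
Qed.

End integration.

(** * Charges with two atoms *)

Section two_point_charge.
Context {K : ptopologicalType} {R : realType}.
Context (compK : compact [set: K]) (hausK : hausdorff_space K).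

Definition two_point_charge (c d : R) (p q : K) : {charge set (borel K) -> \bar R} :=
  cadd (cscale c (charge_of_finite_measure (@dirac _ (borel K) p R)))
       (cscale d (charge_of_finite_measure (@dirac _ (borel K) q R))).

Lemma two_point_chargeE c d p q (A : set K) :
  two_point_charge c d p q A = (c * (\1_A p) + d * (\1_A q))%:E.
Proof. by []. Qed.

Lemma borel_singleton (p : K) : measurable ([set p] : set (borel K)).
Proof. by apply: closed_borel; exact: closed_singleton. Qed.

Lemma Rintegral_two_point (mu : {finite_measure set (borel K) -> \bar R})
    (p q : K) (f : continuousType K R) : p <> q -> mu (~` [set p; q]) = 0%E ->
  Rintegral mu [set: borel K] f =
  f p * fine (mu [set p]) + f q * fine (mu [set q]).
Proof.
move=> pq mu0.
have mpq : measurable ([set p; q] : set (borel K)).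
  by apply: measurableU; exact: borel_singleton.
have intf := integrable_cts compK mu f.
rewrite /Rintegral (negligible_integral (measurableC mpq) _ intf mu0)//.
rewrite setTD setCK -/(Rintegral mu _ f) Rintegral_setU.
- have at1 r : Rintegral mu [set r] f = f r * fine (mu [set r]).
    rewrite -Rintegral_cst; last exact: borel_singleton.
    by apply: eq_Rintegral => z; rewrite inE => ->.
  by rewrite !at1.
- exact: borel_singleton.
- exact: borel_singleton.
- exact: integrableS intf.
- by apply/disj_setPS => z /= [-> /pq].
Qed.

(** The Jordan parts are, up to sign, restrictions of the charge to the Hahn
    sets, so they vanish on a set all of whose subsets have charge 0. Hence they
    are concentrated on the two points, whatever the Hahn decomposition. *)
Lemma jordan_two_point_null c d p q (P N A : set (borel K))
    (nuPN : hahn_decomposition (two_point_charge c d p q) P N) :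
  measurable A -> ~ A p -> ~ A q ->
  jordan_pos nuPN A = 0%E /\ jordan_neg nuPN A = 0%E.
Proof.
move=> mA Ap Aq.
have null B : two_point_charge c d p q (A `&` B) = 0%E.
  rewrite two_point_chargeE !indicE !memNset ?mulr0 ?addr0//.
    by move=> [].
  by move=> [].
rewrite jordan_posE cjordan_posE jordan_negE cjordan_negE.
by rewrite /crestr0 !mem_set// /crestr !null oppe0.
Qed.

Lemma charge_integral_two_point c d p q (f : continuousType K R) : p <> q ->
  charge_integral (two_point_charge c d p q) f = c * f p + d * f q.
Proof.
move=> pq; rewrite /charge_integral; set nuPN := hahn_posneg _.
have mF : measurable (~` [set p; q] : set (borel K)).
  by apply: measurableC; apply: measurableU; exact: borel_singleton.
have [pos0 neg0] : jordan_pos nuPN (~` [set p; q]) = 0%E /\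
    jordan_neg nuPN (~` [set p; q]) = 0%E.
  by apply: jordan_two_point_null => //=; apply; [left|right].
rewrite (Rintegral_two_point _ pq pos0) (Rintegral_two_point _ pq neg0).
have at1 r : fine (two_point_charge c d p q [set r]) =
    fine (jordan_pos nuPN [set r]) - fine (jordan_neg nuPN [set r]).
  rewrite (jordan_decomp nuPN (borel_singleton r)) /cadd /= cscaleN1 fineB//.
  - by apply: fin_num_measure; exact: borel_singleton.
  - by apply: fin_num_measure; exact: borel_singleton.
have := at1 p; have := at1 q; rewrite !two_point_chargeE !indicE !in_set1.
have /negbTE pqF : p != q by apply/eqP.
rewrite !eqxx (eq_sym q) pqF /=.
nra.
Qed.

(** The measure of A only depends on the trace of A on the finite set F.
    The open set ~` (F `\` A) and the compact set A `&` F have the same trace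
    as A, so they attain the infimum and the supremum. *)
Lemma regular_finite_support (mu : {measure set (borel K) -> \bar R})
    (F : set K) : finite_set F -> mu (~` F) = 0%E -> regular_measure mu.
Proof.
move=> finF mu0.
have closedF B : B `<=` F -> closed B.
  move=> BF; apply: accessible_finite_set_closed.1 _ _.
  + exact: hausdorff_accessible.
  + exact: sub_finite_set finF.
have borelF B : B `<=` F -> measurable (B : set (borel K)).
  by move=> /closedF; exact: closed_borel.
have trace A B : measurable (A : set (borel K)) -> measurable (B : set (borel K)) ->
    A `&` F = B `&` F -> mu A = mu B.
  have muI C : measurable (C : set (borel K)) -> mu C = mu (C `&` F).
    move=> mC; rewrite [LHS](measureDI mu mC (borelF _ (@subset_refl _ F))).
    rewrite [X in (X + _)%E](_ : _ = 0%E) ?add0e//.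
    apply: (@subset_measure0 _ _ _ mu _ (~` F)) => //.
    - by apply: measurableD => //; exact: borelF.
    - by apply: measurableC; exact: borelF.
  by move=> mA mB AB; rewrite muI// AB -muI.
move=> A mA.
have oU : open (~` (F `\` A)) by rewrite openC; apply: closedF => z [].
split; apply/eqP; rewrite eq_le; apply/andP; split.
- apply: le_ereal_inf_tmp => _ [U [oU' AU] <-].
  by apply: le_measure => //; rewrite inE//; exact: open_borel.
- apply: ereal_inf_lbound; exists (~` (F `\` A)).
    by split => // z Az [].
  apply: trace => //; first exact: open_borel.
  by apply/seteqP; split => z /= [h Fz]; split => //; [apply: contrapT => ?; exact: h|case].
- apply: ereal_sup_ubound; exists (A `&` F).
    split; last exact: subIsetl.
    by apply: (subclosed_compact _ compK) => //; apply: closedF; exact: subIsetr.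
  apply: trace => //; first by apply: borelF; exact: subIsetr.
  by rewrite -setIA setIid.
- apply: ge_ereal_sup => _ [C [cC CA] <-].
  apply: le_measure => //; rewrite inE//; apply: closed_borel.
  exact: compact_closed.
Qed.

Lemma regular_two_point_charge c d p q :
  regular_charge (two_point_charge c d p q).
Proof.
apply: (@regular_finite_support _ [set p; q]); first exact: finite_set2.
set nuPN := hahn_posneg _.
have [] := @jordan_two_point_null c d p q _ _ (~` [set p; q]) nuPN.
- by apply: measurableC; apply: measurableU; exact: borel_singleton.
- by apply; left.
- by apply; right.
move=> p0 n0; rewrite -[LHS]/(jordan_pos nuPN _ + jordan_neg nuPN _)%E.
by rewrite p0 n0 adde0.
Qed.

End two_point_charge.

(** * The pairing *)

Section duality.
Context {K : ptopologicalType} {R : realType}.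
Context (compK : compact [set: K]).
Implicit Types (f g x : continuousType K R) (P : continuousType K R -> R).
Implicit Types nu : {charge set (borel K) -> \bar R}.

(** Both f + M and M are n-th powers for M = ||f||_oo, so the integral of f is
    a difference of two values of the represented polynomial. *)
Lemma represents_uniq n nu nu' P f : (0 < n)%N ->
  represents n nu P -> represents n nu' P ->
  charge_integral nu f = charge_integral nu' f.
Proof.
move=> n0 nuP nuP'.
pose M : continuousType K R := cst (supnorm f).
have [t|x xE] := @exists_root _ _ n (f + M) n0.
  have : `|f t| <= M t by exact: le_supnorm.
  by rewrite ler_norml => /andP[? _]; rewrite [leRHS](_ : _ = f t + M t)//; lra.
have [t|y yE] := @exists_root _ _ n M n0; first exact: supnorm_ge0.
suff E mu : represents n mu P -> charge_integral mu f = P x - P y.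
  by rewrite !E.
move=> muP; rewrite !muP.
have -> : (fun t => x t ^+ n) = (f + M : continuousType K R).
  by apply/funext => t; case: (xE t).
have -> : (fun t => y t ^+ n) = M.
  by apply/funext => t; case: (yE t).
by rewrite -[f]scale1r !charge_integral_linear// scale1r; lra.
Qed.

Lemma dualityE n nu P f : (0 < n)%N -> regular_charge nu -> represents n nu P ->
  duality n f P = charge_integral nu f.
Proof.
move=> n0 rnu nuP; rewrite /duality.
set S := (X in xget 0 X).
have [nu' [_ nuP' ->]] : S (xget 0 S) by apply: xgetI; exists nu; split.
exact: represents_uniq nuP' nuP.
Qed.

(** The default value of the pairing is 0, so a nonzero pairing produces a
    representing charge. *)
Lemma duality_neq0 n P f : duality n f P != 0 ->
  exists2 nu, represents n nu P & duality n f P = charge_integral nu f.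
Proof.
rewrite /duality; case: xgetP => [r -> [nu [_ nuP ->]] _|_]; last by rewrite eqxx.
by exists nu.
Qed.

(** A function with values in [0, 1] is the n-th power of a function in the
    unit ball of C(K). *)
Lemma ball_charge_bound n nu P f : (0 < n)%N -> homogeneous_poly n P ->
  polynorm P <= 1 -> represents n nu P -> (forall t, 0 <= f t <= 1) ->
  `|charge_integral nu f| <= 1.
Proof.
move=> n0 hP P1 nuP f01.
have [t|x xE] := @exists_root _ _ n f n0; first by case/andP: (f01 t).
have -> : (f : K -> R) = (fun t => x t ^+ n).
  by apply/funext => t; case: (xE t).
rewrite -nuP (le_trans _ P1)//; apply: (le_polynorm compK hP).
apply/(supnorm_le1 compK) => t; have [x0 xtn] := xE t.
by rewrite ger0_norm// -(@expr_le1 _ n)// xtn; case/andP: (f01 t).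
Qed.

Context (hausK : hausdorff_space K).

Lemma duality_two_point n c d p q f : (0 < n)%N -> p <> q ->
  duality n f (two_point_poly n c d p q) = c * f p + d * f q.
Proof.
move=> n0 pq; rewrite (dualityE (nu := two_point_charge c d p q))//.
- exact: charge_integral_two_point.
- exact: regular_two_point_charge.
- by move=> x; rewrite (charge_integral_two_point compK hausK c d (cts_pow n x)).
Qed.

End duality.

(** * Strongly exposed two-point polynomials *)

Section exposed_points.
Context {K : ptopologicalType} {R : realType}.
Context (compK : compact [set: K]) (hausK : hausdorff_space K).
Context (n : nat) (n_gt0 : (0 < n)%N) (n_even : ~~ odd n).
Implicit Types f g x phi : continuousType K R.

(** Moving the atom at p to nearby points changes the pairing with phi as little
    as desired, but the norm by at least |c|. *)
Lemma exposed_two_point_isolated (c d : R) (p q : K) :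
  c != 0 -> unit_weights c d -> p <> q ->
  weak_star_strongly_exposed_poly n (two_point_poly n c d p q) ->
  isolated [set: K] p.
Proof.
move=> c0 cd pq [_ [phi [_ phi1 exp]]]; apply: contrapT => isoNp.
have /choice[r rP] (k : nat) : exists r,
    [/\ r <> p, r <> q & `|phi p - phi r| < k.+1%:R^-1].
  have k0 : 0 < k.+1%:R^-1 :> R by rewrite invr_gt0.
  have := @cts_fun _ _ phi p; move=> /cvgrPdist_lt/(_ _ k0) near_phi.
  (* Avoiding q keeps the two atoms distinct, which the formula for the
     pairing requires. *)
  have near_q : nbhs p (~` [set q]).
    by apply: open_nbhs_nbhs; split => //; rewrite openC; exact: closed_singleton.
  have [r [rq rphi] rp] := not_isolated isoNp (filterI near_q near_phi).
  by exists r; split.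
have phi_r : phi (r k) @[k --> \oo] --> phi p.
  apply/cvgrPdist_lt => e e0.
  apply: filterS (near_infty_natSinv_lt (PosNum e0)) => k /=.
  by have [_ _] := rP k; exact: lt_trans.
have u_ball k := two_point_poly_ball (K := K) compK (r k) q n_gt0 n_even cd.
have /cvgrPdist_lt/(_ `|c|) : polynorm (two_point_poly n c d (r k) q -
    two_point_poly n c d p q : continuousType K R -> R) @[k --> \oo] --> (0 : R).
  apply: exp => //.
  have -> : (fun k => duality n phi (two_point_poly n c d (r k) q)) =
      (fun k => c * phi (r k) + d * phi q).
    by apply/funext => k; have [_ rq _] := rP k; exact: duality_two_point.
  rewrite -phi1 (duality_two_point compK hausK)//.
  by apply: cvgD; [apply: cvgM; [exact: cvg_cst|exact: phi_r]|exact: cvg_cst].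
rewrite normr_gt0 => /(_ c0) [N _ /(_ N (leqnn N))] /=.
rewrite sub0r normrN; apply/negP; rewrite -leNgt.
have -> : two_point_poly n c d (r N) q - two_point_poly n c d p q =
    two_point_poly n c (- c) (r N) p :> (continuousType K R -> R).
  apply/funext => x.
  rewrite -[LHS]/(two_point_poly n c d (r N) q x - two_point_poly n c d p q x).
  by rewrite /two_point_poly; lra.
have [rp _ _] := rP N.
have [e [e01 ep er]] := exists_separating (R := R) compK hausK (nesym rp).
rewrite (le_trans _ (ler_norm _))//.
have e1 : supnorm e <= 1.
  apply: supnorm_le => t; have /andP[? ?] := e01 t.
  by rewrite ger0_norm.
rewrite (le_trans _ (le_polynorm compK (two_point_poly_homogeneous compK n c (- c) (r N) p) e1))//.
by rewrite /two_point_poly ep er expr1n expr0n gtn_eqF// mulr0 mulr1 addr0.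
Qed.

(** Strong exposedness reduces to an estimate for linear functionals that are
    bounded by 1 on the functions with values in [0, 1]: its left-hand side at
    f = x ^+ n is the value at x of the difference of polynomials, and
    its right-hand side tends to 0 along a sequence whose pairings tend to 1. *)
Lemma two_point_exposed (c d : R) (p q : K) phi : unit_weights c d -> p <> q ->
  dnorm phi = 1 -> c * phi p + d * phi q = 1 ->
  (forall L : continuousType K R -> R,
    {morph L : f g / f + g} -> (forall a, {morph L : f / a *: f >-> a * f}) ->
    (forall f, (forall t, 0 <= f t <= 1) -> `|L f| <= 1) ->
    forall f, (forall t, 0 <= f t <= 1) ->
      `|L f - (c * f p + d * f q)| <= 4 * (1 - L phi)) ->
  weak_star_strongly_exposed_poly n (two_point_poly n c d p q).
Proof.
move=> cd pq phi1 phi_u est; split; first exact: two_point_poly_ball.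
exists phi; split => //; first by rewrite (duality_two_point compK hausK).
move=> u u_ball phi_cvg.
have upper : 4 * (1 - duality n phi (u k)) @[k --> \oo] --> (0 : R).
  rewrite [X in _ --> X](_ : 0 = 4 * (1 - 1)); last by rewrite subrr mulr0.
  by apply: cvgM; [exact: cvg_cst|apply: cvgB; [exact: cvg_cst|]].
apply: (squeeze_cvgr _ (cvg_cst 0) upper).
have := phi_cvg; move=> /cvgrPdist_lt/(_ 1 ltr01); apply: filterS => k phik.
rewrite polynorm_ge0/=.
have /duality_neq0[nu nu_u ->] : duality n phi (u k) != 0.
  by apply: contraTneq phik => ->; rewrite subr0 normr1 ltxx.
have [[hom_u _] u1] := u_ball k.
apply: polynorm_le => x x1.
rewrite -[X in `|X|]/(u k x - two_point_poly n c d p q x) nu_u.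
pose L f : R := charge_integral nu f.
have lin a f g : L (a *: f + g) = a * L f + L g by exact: charge_integral_linear.
have lin0 : L 0 = 0 by have := lin (-1) 0 0; rewrite scaler0 addr0; lra.
apply: (est L _ _ _ (cts_pow n x)).
- by move=> f g; rewrite -[f in LHS]scale1r lin mul1r.
- by move=> a f; rewrite -[X in L X]addr0 lin lin0 addr0.
- by move=> f; exact: ball_charge_bound u1 nu_u.
- by move=> t; exact: pow_itv.
Qed.

Lemma supnorm_funrpos (h : K -> R) p :
  0 <= h p -> (forall t, h t <= h p) -> supnorm h^\+ = h p.
Proof.
move=> hp0 hp; have posp : h^\+ p = h p by exact/max_idPl.
rewrite (@supnorm_max _ _ _ p) => [|t]; first by rewrite posp ger0_norm.
by rewrite posp !ger0_norm ?funrpos_ge0// /funrpos ge_max hp.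
Qed.

Lemma supnorm_funrneg (h : K -> R) q :
  h q <= 0 -> (forall t, h q <= h t) -> supnorm h^\- = - h q.
Proof.
move=> hq0 hq; rewrite -funrposN (@supnorm_funrpos _ q)//= ?oppr_ge0// => t.
by rewrite lerN2.
Qed.

Lemma supnorm_funrneg0 (h : K -> R) :
  (forall t, 0 <= h t) -> supnorm h^\- = 0.
Proof.
move=> h0; have -> : h^\- = cst 0.
  by apply/funext => t; apply/max_idPr; rewrite oppr_le0.
by rewrite (@supnorm_max _ _ _ point)//= normr0.
Qed.

(** The indicator e of p alone does not expose delta_p^n, since it does not
    separate it from delta_p^n - delta_q^n. With phi = (e + 1) / 2, L phi close to 1
    forces both L e and L 1 to be close to 1. For g = f - f(p) e, supported off p,
    the functions e + g and 1 - g have values in [0, 1], so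
    L 1 - 1 <= L g <= 1 - L e. *)
Lemma isolated_exposed_one (p q : K) : p <> q -> isolated [set: K] p ->
  weak_star_strongly_exposed_poly n (two_point_poly n 1 0 p q : continuousType K R -> R).
Proof.
move=> pq isop; have [e eE] := exists_indic (R := R) hausK isop.
pose one : continuousType K R := cst 1.
pose phi : continuousType K R := 2^-1 *: e + 2^-1 *: one.
have phiE t : phi t = 2^-1 * (t == p)%:R + 2^-1 by rewrite -eE -[X in _ + X]mulr1.
have qpF : (q == p) = false by apply/eqP => /esym.
apply: (two_point_exposed (phi := phi)) => //.
- by move=> a b a01 b01; rewrite ler_norml; lra.
- have pos : supnorm phi^\+ = phi p.
    apply: supnorm_funrpos => [|t]; rewrite !phiE eqxx /=; first by lra.
    by case: eqP => _ /=; lra.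
  have neg : supnorm phi^\- = 0.
    by apply: supnorm_funrneg0 => t; rewrite phiE; case: eqP => _ /=; lra.
  by rewrite /dnorm pos neg phiE eqxx /=; lra.
- by rewrite !phiE eqxx /=; lra.
move=> L LD LZ L1 f f01.
pose g := f - f p *: e.
have gE t : g t = f t - f p * (t == p)%:R by rewrite -eE.
have Lphi : L phi = 2^-1 * L e + 2^-1 * L one by rewrite LD !LZ.
have Lf : L f = L g + f p * L e by rewrite -LZ -LD subrK.
have one1 : `|L one| <= 1 by apply: L1 => t; rewrite ler01 lexx.
have e1 : `|L e| <= 1 by apply: L1 => t; rewrite eE; case: eqP => _ /=; lra.
have eg1 : `|L e + L g| <= 1.
  rewrite -LD; apply: L1 => t; rewrite [X in 0 <= X <= _](_ : _ = e t + g t)// eE gE.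
  have := f01 t; have := f01 p.
  by case: eqP => [->|_] /=; lra.
have oneg1 : `|L one + -1 * L g| <= 1.
  rewrite -LZ -LD; apply: L1 => t; rewrite [X in 0 <= X <= _](_ : _ = 1 + -1 * g t)// gE.
  have := f01 t; have := f01 p.
  by case: eqP => [->|_] /=; lra.
move: one1 e1 eg1 oneg1; rewrite Lphi Lf !ler_norml.
have /andP[fp0 fp1] := f01 p.
move=> /andP[_ one1] /andP[_ e1] /andP[_ eg1] /andP[_ oneg1].
have eL0 : 0 <= 1 - L e by lra.
have : 0 <= f p * (1 - L e) by exact: mulr_ge0.
have : 0 <= (1 - f p) * (1 - L e) by rewrite mulr_ge0//; lra.
by move=> ? ?; apply/andP; split; lra.
Qed.

(** Let e and d be the indicators of p and q, and phi = (e - d) / 2. Then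
    L phi close to 1 forces L e close to 1 and L d close to -1. For the part g of
    f supported off p and q, the functions e + g and d + g have values in [0, 1],
    so - 1 - L d <= L g <= 1 - L e. *)
Lemma isolated_exposed_sub (p q : K) : p <> q ->
  isolated [set: K] p -> isolated [set: K] q ->
  weak_star_strongly_exposed_poly n (two_point_poly n 1 (-1) p q : continuousType K R -> R).
Proof.
move=> pq isop isoq.
have [e eE] := exists_indic (R := R) hausK isop.
have [d dE] := exists_indic (R := R) hausK isoq.
pose phi : continuousType K R := 2^-1 *: e - 2^-1 *: d.
have phiE t : phi t = 2^-1 * (t == p)%:R - 2^-1 * (t == q)%:R by rewrite -eE -dE.
have pqF : (p == q) = false by apply/eqP.
have qpF : (q == p) = false by apply/eqP => /esym.
have edE t : (t == p)%:R + (t == q)%:R <= 1 :> R.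
  by case: (t =P p) => [->|_]; rewrite ?pqF; [|case: (t =P q) => _] => /=; lra.
apply: (two_point_exposed (phi := phi)) => //.
- by move=> a b a01 b01; rewrite ler_norml; lra.
- have pos : supnorm phi^\+ = phi p.
    apply: supnorm_funrpos => [|t]; rewrite !phiE eqxx pqF /=; first by lra.
    by have := edE t; case: (t =P p) => _; case: (t =P q) => _ /=; lra.
  have neg : supnorm phi^\- = - phi q.
    apply: supnorm_funrneg => [|t]; rewrite !phiE eqxx qpF /=; first by lra.
    by have := edE t; case: (t =P p) => _; case: (t =P q) => _ /=; lra.
  by rewrite /dnorm pos neg !phiE !eqxx pqF qpF /=; lra.
- by rewrite !phiE !eqxx pqF qpF /=; lra.
move=> L LD LZ L1 f f01.
pose g := f + (- f p) *: e + (- f q) *: d.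
have gE t : g t = f t - f p * (t == p)%:R - f q * (t == q)%:R.
  by rewrite -eE -dE -!mulNr.
have Lphi : L phi = 2^-1 * L e - 2^-1 * L d by rewrite LD -scaleNr !LZ mulNr.
have Lg : L g = L f - f p * L e - f q * L d by rewrite !LD !LZ !mulNr.
have e1 : `|L e| <= 1 by apply: L1 => t; rewrite eE; case: eqP => _ /=; lra.
have d1 : `|L d| <= 1 by apply: L1 => t; rewrite dE; case: eqP => _ /=; lra.
have eg1 : `|L e + L g| <= 1.
  rewrite -LD; apply: L1 => t; rewrite [X in 0 <= X <= _](_ : _ = e t + g t)// eE gE.
  have := f01 t; have := f01 p; have := f01 q.
  case: (t =P p) => [->|_]; rewrite ?pqF /=; first by lra.
  by case: eqP => [->|_] /=; lra.
have dg1 : `|L d + L g| <= 1.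
  rewrite -LD; apply: L1 => t; rewrite [X in 0 <= X <= _](_ : _ = d t + g t)// dE gE.
  have := f01 t; have := f01 p; have := f01 q.
  case: (t =P p) => [->|_]; rewrite ?pqF /=; first by lra.
  by case: eqP => [->|_] /=; lra.
move: e1 d1 eg1 dg1; rewrite Lphi Lg !ler_norml.
have /andP[fp0 fp1] := f01 p; have /andP[fq0 fq1] := f01 q.
move=> /andP[_ e1] /andP[d1 _] /andP[_ eg1] /andP[dg1 _].
have eL0 : 0 <= 1 - L e by lra.
have dL0 : 0 <= 1 + L d by lra.
have : 0 <= f p * (1 - L e) by exact: mulr_ge0.
have : 0 <= (1 - f p) * (1 - L e) by rewrite mulr_ge0//; lra.
have : 0 <= f q * (1 + L d) by exact: mulr_ge0.
have : 0 <= (1 - f q) * (1 + L d) by rewrite mulr_ge0//; lra.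
by move=> ? ? ? ?; apply/andP; split; lra.
Qed.

End exposed_points.

Theorem proposition9 (R : realType) (K : ptopologicalType)
  (compK : compact [set: K]) (hausK : hausdorff_space K)
  (n : nat) (n_gt0 : (0 < n)%N) (n_even : ~~ odd n)
  (s t : K) (st : s <> t) :
  (weak_star_strongly_exposed_poly n
     (delta_poly n t : continuousType K R -> R) <->
   isolated [set: K] t) /\
  (weak_star_strongly_exposed_poly n
     (delta_poly n t - delta_poly n s : continuousType K R -> R) <->
   isolated [set: K] t /\ isolated [set: K] s).
Proof.
have ts : t <> s by exact: nesym.
have w10 : unit_weights (1 : R) 0 by move=> a b ? ?; rewrite ler_norml; lra.
have w1N1 : unit_weights (1 : R) (-1) by move=> a b ? ?; rewrite ler_norml; lra.
have wN11 : unit_weights (-1 : R) 1 by move=> a b ? ?; rewrite ler_norml; lra.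
split.
  rewrite (delta_two_point n t s); split; last exact: isolated_exposed_one.
  exact: (exposed_two_point_isolated _ _ _ _ (oner_neq0 R)).
rewrite delta_sub_two_point; split; last first.
  by move=> [isot isos]; exact: isolated_exposed_sub.
move=> exp; split.
  exact: (exposed_two_point_isolated _ _ _ _ (oner_neq0 R) w1N1 ts exp).
have N1 : -1 != 0 :> R by rewrite oppr_eq0 oner_neq0.
rewrite two_point_polyC in exp.
exact: (exposed_two_point_isolated _ _ _ _ N1 wN11 st exp).
Qed.
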